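(* Let $W$ be a finite topological space. The following statements are equivalent: 1. there exists a transformation semigroup $(K,H)$ with $K$ a finite discrete space whose indicator topological space is homeomorphic to $W$; 2. there exists a Fort transformation semigroup $(X,S)$ whose indicator topological space is homeomorphic to $W$; 3. there exists a transformation semigroup $(Z,T)$ whose indicator topological space is homeomorphic to $W$.
   Context: A transformation semigroup $(Y,S)$ consists of a (nonempty) compact Hausdorff space $Y$, a discrete semigroup $S$ with identity $e$, and a continuous map $Y\times S\to Y$, $(x,s)\mapsto xs$, with $xe=x$ and $x(st)=(xs)t$ for all $x\in Y$, $s,t\in S$. Write $xS=\{xs:s\in S\}$. The indicator topological space of $(Y,S)$ is the set $\{\overline{xS}:x\in Y\}$ with the topology having as a basis the collection of sets $\{\overline{yS}: y\in\overline{xS}\}$, $x\in Y$. A Fort space with particular point $b\in X$ is a set $X$ with the topology $\{U\subseteq X: b\notin U\text{ or }X\setminus U\text{ is finite}\}$ ($X$ may be finite or infinite). A Fort transformation semigroup is a transformation semigroup whose phase space is a Fort space. *)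

(* Defs.v *)
From HB Require Import structures.
From mathcomp Require Import all_boot all_classical topology.

Set Implicit Arguments.
Unset Strict Implicit.
Unset Printing Implicit Defensive.

Local Open Scope classical_set_scope.

(* The semigroup with identity is a [monoidType]; being discrete is expressed
   by giving it the topology of [discrete_topology S] in [ts_continuous]. *)
Record transformation_semigroup (Y : topologicalType) (S : monoidType) :=
  TransformationSemigroup {
  ts_act :> Y -> S -> Y ;
  ts_nonempty : [set: Y] !=set0 ;
  ts_compact : compact [set: Y] ;
  ts_hausdorff : hausdorff_space Y ;
  ts_continuous :
    continuous (fun p : Y * discrete_topology S => ts_act p.1 p.2) ;
  ts_act1 : forall x : Y, ts_act x 1%g = x ;
  ts_actM : forall (x : Y) (s t : S), ts_act x (s * t)%g = ts_act (ts_act x s) t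
}.

Section Indicator.
Context {Y : topologicalType} {S : monoidType}.
Variable a : transformation_semigroup Y S.

Definition ts_orbit (x : Y) : set Y := range (a x).

Definition orbit_closure (x : Y) : set Y := closure (ts_orbit x).

Definition indicator : Type := set_type (range orbit_closure).

HB.instance Definition _ :=
  Choice.copy indicator (set_type (range orbit_closure)).

Definition to_indicator (x : Y) : indicator :=
  SigSub (mem_set (imageT orbit_closure x)).

Definition indicator_basic (x : Y) : set indicator :=
  to_indicator @` orbit_closure x.

Definition indicator_basis : set (set indicator) := range indicator_basic.

Lemma orbit_closure_refl (x : Y) : orbit_closure x x.
Proof. by apply: subset_closure; exists 1%g => //; exact: ts_act1. Qed.

Lemma orbit_closure_sub (x y : Y) :
  orbit_closure x y -> orbit_closure y `<=` orbit_closure x.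
Proof.
move=> xy; rewrite /orbit_closure.
rewrite [X in _ `<=` X](proj1 (closure_id _) (@closed_closure _ (ts_orbit x))).
apply: closureS => _ [s _ <-] V.
move=> /(@ts_continuous _ _ a (y, s)) [[A B] /= [Ay Bs] AB].
have [_ [[t _ <-] At]] := xy A Ay.
exists (a (a x t) s); split; first by exists (t * s)%g => //; rewrite ts_actM.
by apply: (AB (a x t, s)); split => //; exact: nbhs_singleton Bs.
Qed.

(* The [id]s are the indexing function that [isBaseTopological] expects. *)
Lemma indicator_basis_cover : \bigcup_(B in indicator_basis) id B = setT.
Proof.
apply/seteqP; split=> // -[A Ax] _.
have [x _ xA] := set_mem Ax; exists (indicator_basic x); first by exists x.
by exists x; [exact: orbit_closure_refl | exact: val_inj].
Qed.

Lemma indicator_basis_join (B C : set indicator) (w : indicator) :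
  indicator_basis B -> indicator_basis C -> id B w -> id C w ->
  exists D, [/\ indicator_basis D, id D w & id D `<=` id B `&` id C].
Proof.
move=> [x _ <-] [x' _ <-] [y xy <-] [y' xy' /(congr1 val) /= yy'].
exists (indicator_basic y); split; first by exists y.
  by exists y => //; exact: orbit_closure_refl.
move=> _ [z yz <-]; split; exists z => //; first exact: orbit_closure_sub yz.
by apply: (orbit_closure_sub xy'); rewrite yy'.
Qed.

HB.instance Definition _ := isBaseTopological.Build indicator
  indicator_basis_cover indicator_basis_join.

Lemma indicator_openE (U : set indicator) :
  open U <-> exists2 D : set (set indicator),
    D `<=` indicator_basis & U = \bigcup_(B in D) B.
Proof. by split=> [[D DB <-]|[D DB ->]]; exists D. Qed.

End Indicator.

Definition fort_space (X : topologicalType) : Prop :=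
  exists b : X, forall U : set X, open U <-> ~ U b \/ finite_set (~` U).

Definition homeomorphic (X Y : topologicalType) : Prop :=
  exists (f : X -> Y) (g : Y -> X),
    [/\ cancel f g, cancel g f, continuous f & continuous g].

(* Main.v *)
Require Import Defs.
From HB Require Import structures.
From mathcomp Require Import all_boot all_order all_classical topology.

Import Order.TTheory.

Local Open Scope classical_set_scope.

(** An indicator space is a poset in disguise: its points are orbit closures,
    ordered by inclusion, and because the closure of [yS] is contained in the
    closure of [xS] exactly when [y] lies in the latter, the basic open sets
    are the principal down-sets. Its topology is therefore the one whose open
    sets are the down-sets ([indicator_open_downset]), so an isomorphism of the
    posets is a homeomorphism of the indicator spaces.

    Only the step from an arbitrary transformation semigroup to a finite one
    has content, and it amounts to realising every nonempty finite poset [P]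
    as the inclusion poset of the orbit closures of an action on a finite
    discrete space. The action is the one on [P] itself by the monoid of its
    regressive maps, the maps [f] with [f x <= x] everywhere. The orbit of [x]
    is then exactly the down-set of [x]: nothing above or beside [x] can be
    reached, while each [y <= x] is reached by the map that moves [x] to [y]
    and fixes the rest. Orbits are closed since [P] is discrete, and the
    inclusion order on principal down-sets is the order of [P]
    ([le_regressive_indicator]). For [P] the poset of a finite indicator space
    this recovers that indicator space
    ([regressive_indicator_homeomorphic]).

    A finite discrete space is a Fort space, for any choice of the particular
    point, which closes the cycle of implications. *)

Lemma homeomorphic_trans {X Y Z : topologicalType} :
  homeomorphic X Y -> homeomorphic Y Z -> homeomorphic X Z.
Proof.
move=> [f [f' [fK f'K cf cf']]] [g [g' [gK g'K cg cg']]].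
exists (g \o f), (f' \o g'); split.
- exact: can_comp gK fK.
- exact: can_comp f'K g'K.
- by move=> x; apply: continuous_comp; [exact: cf | exact: cg].
- by move=> x; apply: continuous_comp; [exact: cg' | exact: cf'].
Qed.

Section IndicatorOrder.
Context {Y : topologicalType} {S : monoidType}.
Variable a : transformation_semigroup Y S.

HB.instance Definition _ := SubChoice.on (indicator a).
HB.instance Definition _ :=
  [SubChoice_isSubPOrder of indicator a by <: with set_display].

Lemma to_indicator_surj (i : indicator a) : exists x, to_indicator a x = i.
Proof.
case: i => A Ax; have [x _ xA] := set_mem Ax.
by exists x; exact: val_inj.
Qed.

(** An orbit closure is closed and invariant under the action, so it contains
    the closure of [yS] as soon as it contains [y]. *)
Lemma le_to_indicator (x y : Y) :
  (to_indicator a y <= to_indicator a x)%O <-> orbit_closure a x y.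
Proof.
rewrite -Order.le_val /= subsetEset.
split=> [|/orbit_closure_sub//].
by apply; exact: orbit_closure_refl.
Qed.

(** The basic open set at [x] is the principal down-set of the closure of [xS];
    unions of principal down-sets are down-sets, and a down-set is the union of
    the principal down-sets of its points. *)
Lemma indicator_open_downset (U : set (indicator a)) :
  open U <-> forall i j : indicator a, (i <= j)%O -> U j -> U i.
Proof.
rewrite indicator_openE; split=> [[D DB ->] i j|Udown].
  have [x <-] := to_indicator_surj i; move=> ij [B DBB jB].
  have [z _ zB] := DB _ DBB; exists B => //; move: jB; rewrite -zB.
  move=> [y zy yj]; exists x => //.
  by apply: (orbit_closure_sub zy); apply/le_to_indicator; rewrite yj.
exists [set indicator_basic x | x in to_indicator a @^-1` U].
  by move=> _ [x _ <-]; exists x.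
apply/seteqP; split=> [i|_ [_ [x Ux <-]] [y xy <-]].
  have [x <-] := to_indicator_surj i => Ux.
  exists (indicator_basic x); first by exists x.
  by exists x => //; exact: orbit_closure_refl.
by apply: Udown Ux; apply/le_to_indicator.
Qed.

End IndicatorOrder.

(** Preimages of down-sets under monotone maps are down-sets. *)
Lemma indicator_continuous {Y Y' : topologicalType} {S S' : monoidType}
    (a : transformation_semigroup Y S) (b : transformation_semigroup Y' S')
    (f : indicator a -> indicator b) :
  {homo f : i j / (i <= j)%O} -> continuous f.
Proof.
move=> f_homo; apply/continuousP => U /indicator_open_downset Udown.
by apply/indicator_open_downset => i j /f_homo; exact: Udown.
Qed.

Section Regressive.
Context {d : Order.disp_t} (P : porderType d).

Definition regressive : Type :=
  set_type [set f : P -> P | forall x, (f x <= x)%O].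

HB.instance Definition _ := SubChoice.on regressive.

Lemma regressive_le (f : regressive) (x : P) : (val f x <= x)%O.
Proof. exact: (set_mem (valP f)). Qed.

Definition regressive_id : regressive := SigSub (mem_set (@lexx d P)).

Lemma regressive_comp_le (f g : regressive) (x : P) :
  (val g (val f x) <= x)%O.
Proof. exact: le_trans (regressive_le g _) (regressive_le f x). Qed.

(** The action is on the right, so the left factor is applied first. *)
Definition regressive_mul (f g : regressive) : regressive :=
  SigSub (mem_set (regressive_comp_le f g)).

Fact regressive_mulA : associative regressive_mul.
Proof. by move=> f g h; exact: val_inj. Qed.

Fact regressive_mul1g : left_id regressive_id regressive_mul.
Proof. by move=> f; exact: val_inj. Qed.

Fact regressive_mulg1 : right_id regressive_id regressive_mul.
Proof. by move=> f; exact: val_inj. Qed.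

HB.instance Definition _ :=
  isMonoid.Build regressive regressive_mulA regressive_mul1g regressive_mulg1.

(** The map that moves [x] to [y] and fixes every other point is regressive. *)
Lemma regressive_reach (x y : P) :
  (y <= x)%O -> exists f : regressive, val f x = y.
Proof.
move=> yx.
have f_le z : ((if z == x then y else z) <= z)%O by case: eqVneq => [->|].
by exists (SigSub (mem_set f_le)); rewrite /= eqxx.
Qed.

Definition regressive_act (x : discrete_topology P) (f : regressive) :
  discrete_topology P := val f x.

Hypothesis P_nonempty : [set: P] !=set0.
Hypothesis P_finite : finite_set [set: P].

Fact regressive_act_continuous :
  continuous (fun p : discrete_topology P * discrete_topology regressive =>
                regressive_act p.1 p.2).
Proof.
move=> [x f] U /= /nbhs_singleton Uxf.
exists ([set x], [set f]); first by split; exact: discrete_set1.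
by move=> [_ _] [/= -> ->].
Qed.

Definition regressive_ts :
    transformation_semigroup (discrete_topology P) regressive :=
  @TransformationSemigroup (discrete_topology P) regressive regressive_act
    P_nonempty (@finite_compact (discrete_topology P) _ P_finite)
    discrete_hausdorff regressive_act_continuous
    (fun=> erefl) (fun _ _ _ => erefl).

Lemma regressive_orbit_closure (x y : P) :
  orbit_closure regressive_ts x y <-> (y <= x)%O.
Proof.
rewrite /orbit_closure.
rewrite -(proj1 (closure_id _) (discrete_closed (ts_orbit regressive_ts x))).
split=> [[f _ <-]|/regressive_reach[f fx]]; first exact: regressive_le.
by exists f.
Qed.

Lemma le_regressive_indicator (x y : P) :
  (to_indicator regressive_ts y <= to_indicator regressive_ts x)%O = (y <= x)%O.
Proof.
apply/idP/idP => [/le_to_indicator/regressive_orbit_closure//|yx].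
by apply/le_to_indicator/regressive_orbit_closure.
Qed.

End Regressive.

(** The map sending [i] to its orbit closure under the regressive maps is
    surjective by construction and preserves and reflects the order. Reflecting
    the order makes it injective by antisymmetry, so it is an isomorphism of
    posets. *)
Lemma regressive_indicator_homeomorphic {Z : topologicalType} {T : monoidType}
    (a : transformation_semigroup Z T)
    (I_nonempty : [set: indicator a] !=set0)
    (I_finite : finite_set [set: indicator a]) :
  homeomorphic (indicator (regressive_ts _ I_nonempty I_finite)) (indicator a).
Proof.
set b := regressive_ts _ _ _.
have b_le (i j : indicator a) :
    (to_indicator b i <= to_indicator b j)%O = (i <= j)%O.
  exact: le_regressive_indicator.
have [g gK] := choice (@to_indicator_surj _ _ b).
have bK : cancel (to_indicator b) g.
  by move=> i; apply/eqP; rewrite eq_le -!b_le !gK lexx.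
exists g, (to_indicator b); split => //; apply: indicator_continuous => i j.
  by rewrite -b_le !gK.
by rewrite b_le.
Qed.

(** Any point can be the particular point: when the whole space is finite, all
    complements are finite, so the Fort topology is the discrete one. *)
Lemma finite_discrete_fort_space (K : discreteTopologicalType) :
  [set: K] !=set0 -> finite_set [set: K] -> fort_space K.
Proof.
move=> [b _] K_finite; exists b => U; split=> _; last exact: discrete_open.
by right; exact: sub_finite_set K_finite.
Qed.

Theorem theorem4p1 (W : topologicalType) (W_finite : finite_set [set: W]) :
  [<-> exists (K : discreteTopologicalType) (H : monoidType)
              (a : transformation_semigroup K H),
         finite_set [set: K] /\ homeomorphic (indicator a) W;
       exists (X : topologicalType) (S : monoidType)
              (a : transformation_semigroup X S),
         fort_space X /\ homeomorphic (indicator a) W;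
       exists (Z : topologicalType) (T : monoidType)
              (a : transformation_semigroup Z T),
         homeomorphic (indicator a) W].
Proof.
tfae.
- move=> [K [H [a [K_finite aW]]]]; exists K, H, a; split=> //.
  exact: finite_discrete_fort_space (ts_nonempty a) K_finite.
- by move=> [X [S [a [_ aW]]]]; exists X, S, a.
- move=> [Z [T [a aW]]].
  have I_nonempty : [set: indicator a] !=set0.
    by have [z _] := ts_nonempty a; exists (to_indicator a z).
  have I_finite : finite_set [set: indicator a].
    have [f [g [fK _ _ _]]] := aW.
    apply: sub_finite_set (finite_image g W_finite).
    by move=> i _; exists (f i).
  exists (discrete_topology (indicator a)), (regressive (indicator a)).
  exists (regressive_ts _ I_nonempty I_finite); split=> //.
  exact: homeomorphic_trans (regressive_indicator_homeomorphic _ _ _) aW.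
Qed.
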